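(* Let $(A,\cdot,\Delta,\partial,\eth)$ be a differential antisymmetric infinitesimal bialgebra of weight $0$, and let $\circ:A^*\otimes A^*\to A^*$ be the linear dual of $\Delta$. Let $$x\prec_Ay:=x\cdot\partial(y),\quad x\succ_Ay:=\partial(x)\cdot y,\quad x,y\in A,$$ $$a^*\prec_{A^*}b^*:=a^*\circ\eth^*(b^* ),\quad a^*\succ_{A^*}b^*:=\eth^*(a^* )\circ b^*,\quad a^*,b^*\in A^*,$$ and let $\Delta_{\prec_A},\Delta_{\succ_A}:A\to A\otimes A$ be the linear duals of $\prec_{A^*},\succ_{A^*}$. If $\eth(x)\cdot y=-\partial(x)\cdot y$ for all $x,y\in A$ and $(\eth\otimes\mathrm{id})\Delta=-(\partial\otimes\mathrm{id})\Delta$, then $(A,\prec_A,\succ_A,\Delta_{\prec_A},\Delta_{\succ_A})$ is a noncommutative Novikov bialgebra. In particular, if $\eth=-\partial$, then $(A,\prec_A,\succ_A,\Delta_{\prec_A},\Delta_{\succ_A})$ is a noncommutative Novikov bialgebra.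
   Context: $\mathbf k$ is a field of characteristic $0$; all vector spaces and algebras are finite-dimensional over $\mathbf k$; ''algebra'' means associative algebra, not necessarily commutative or unital. For a bilinear operation $\circ$, $L_\circ(x)y=x\circ y=R_\circ(y)x$; $\psi^*$ is the transpose of a linear map $\psi$; $\sigma(x\otimes y)=y\otimes x$. A product $\circ$ on $A^*$ and a map $\Delta:A\to A\otimes A$ are linear duals of each other if $\langle a^*\circ b^*,x\rangle=\langle a^*\otimes b^*,\Delta(x)\rangle$. Differential antisymmetric infinitesimal (ASI) bialgebra of weight $0$: $(A,\cdot,\Delta,\partial,\eth)$, with $\partial,\eth:A\to A$ linear, such that: (1) $(A,\cdot)$ is an associative algebra, $(A,\Delta)$ is a coassociative coalgebra, $\Delta(xy)=(R_\cdot(y)\otimes\mathrm{id})\Delta(x)+(\mathrm{id}\otimes L_\cdot(x))\Delta(y)$ and $(L_\cdot(x)\otimes\mathrm{id}-\mathrm{id}\otimes R_\cdot(x))\Delta(y)=\sigma\big((\mathrm{id}\otimes R_\cdot(y)-L_\cdot(y)\otimes\mathrm{id})\Delta(x)\big)$ for all $x,y\in A$; (2) $\partial(xy)=\partial(x)y+x\partial(y)$, $\eth(x)y=x\partial(y)+\eth(xy)$ and $x\eth(y)=\partial(x)y+\eth(xy)$ for all $x,y\in A$; (3) $\Delta\eth=(\eth\otimes\mathrm{id}+\mathrm{id}\otimes\eth)\Delta$, $(\partial\otimes\mathrm{id})\Delta=(\mathrm{id}\otimes\eth)\Delta+\Delta\partial$ and $(\mathrm{id}\otimes\partial)\Delta=(\eth\otimes\mathrm{id})\Delta+\Delta\partial$.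 A noncommutative Novikov algebra is a vector space $A$ with bilinear operations $\prec,\succ$ such that, with $\bullet:=\prec+\succ$, $(x\succ y)\prec z=x\succ(y\prec z)$ and $(x\prec y)\bullet z=x\bullet(y\succ z)$. A noncocommutative Novikov coalgebra is $(A,\Delta_\prec,\Delta_\succ)$ with linear maps $\Delta_\prec,\Delta_\succ:A\to A\otimes A$ such that, with $\Delta_\bullet:=\Delta_\prec+\Delta_\succ$, $(\Delta_\succ\otimes\mathrm{id})\Delta_\prec=(\mathrm{id}\otimes\Delta_\prec)\Delta_\succ$ and $(\Delta_\prec\otimes\mathrm{id})\Delta_\bullet=(\mathrm{id}\otimes\Delta_\succ)\Delta_\bullet$. A noncommutative Novikov bialgebra is $(A,\prec,\succ,\Delta_\prec,\Delta_\succ)$ where $(A,\prec,\succ)$ is a noncommutative Novikov algebra, $(A,\Delta_\prec,\Delta_\succ)$ is a noncocommutative Novikov coalgebra, and for all $x,y\in A$: $\Delta_\prec(x\prec y)=(R_\prec(y)\otimes\mathrm{id})\Delta_\prec(x)+(\mathrm{id}\otimes L_\bullet(x))\Delta_\bullet(y)$; $\Delta_\succ(x\succ y)=(R_\bullet(y)\otimes\mathrm{id})\Delta_\bullet(x)+(\mathrm{id}\otimes L_\succ(x))\Delta_\succ(y)$; $(\mathrm{id}\otimes R_\prec(y))\Delta_\bullet(x)+\sigma\big((\mathrm{id}\otimes R_\prec(x))\Delta_\bullet(y)\big)=(L_\succ(y)\otimes\mathrm{id})\Delta_\bullet(x)+\sigma\big((L_\succ(x)\otimes\mathrm{id})\Delta_\bullet(y)\big)$;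 $(L_\bullet(y)\otimes\mathrm{id})\Delta_\prec(x)+\sigma\big((L_\bullet(x)\otimes\mathrm{id})\Delta_\prec(y)\big)=(\mathrm{id}\otimes R_\bullet(y))\Delta_\succ(x)+\sigma\big((\mathrm{id}\otimes R_\bullet(x))\Delta_\succ(y)\big)$. *)

(* Defs.v *)
From HB Require Import structures.
From mathcomp Require Import all_boot all_algebra.

Set Implicit Arguments.
Unset Strict Implicit.
Unset Printing Implicit Defensive.

Import GRing.Theory.
Local Open Scope ring_scope.

(* The tensor product of V and W, realized as the space of coordinate         *)
(* matrices with respect to the reference bases vbasis {:V} and vbasis {:W}.  *)
(* Lemmas tens_linearl, tens_linearr, tlift_tens and tens_ext state its       *)
(* universal property; everything below is built from tens and tlift.         *)
Definition tensor (k : fieldType) (V W : vectType k) : Type :=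
  'M[k]_(\dim {:V}, \dim {:W}).

HB.instance Definition _ (k : fieldType) (V W : vectType k) :=
  Vector.copy (tensor V W) 'M[k]_(\dim {:V}, \dim {:W}).

Notation "V ⊗ W" := (tensor V W) (at level 38, left associativity).

Definition tens (k : fieldType) (V W : vectType k) (v : V) (w : W) : V ⊗ W :=
  \matrix_(i, j) (coord (vbasis {:V}) i v * coord (vbasis {:W}) j w).

(* The linear map sending tens v w to f v w, for bilinear f. *)
Definition tlift (k : fieldType) (V W U : vectType k) (f : V -> W -> U) :
    'Hom(V ⊗ W, U) :=
  linfun (fun t : V ⊗ W =>
    \sum_i \sum_j (t i j : k) *: f (vbasis {:V})`_i (vbasis {:W})`_j).

Definition tmap (k : fieldType) (V W V' W' : vectType k)
    (f : 'Hom(V, V')) (g : 'Hom(W, W')) : 'Hom(V ⊗ W, V' ⊗ W') :=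
  tlift (fun v w => tens (f v) (g w)).

Notation "f ⊗ g" := (tmap f g) (at level 38, left associativity) : lfun_scope.

Definition tflip (k : fieldType) (V W : vectType k) : 'Hom(V ⊗ W, W ⊗ V) :=
  tlift (fun v w => tens w v).

Definition tassoc (k : fieldType) (U V W : vectType k) :
    'Hom(U ⊗ V ⊗ W, U ⊗ (V ⊗ W)) :=
  tlift (fun (t : U ⊗ V) w => tlift (fun u v => tens u (tens v w)) t).

(* a ⊗ b seen as a linear form on V ⊗ W. *)
Definition tpair (k : fieldType) (V W : vectType k)
    (a : 'Hom(V, k^o)) (b : 'Hom(W, k^o)) : 'Hom(V ⊗ W, k^o) :=
  tlift (fun v w => a v * b w : k^o).

Definition transpose (k : fieldType) (V W : vectType k) (psi : 'Hom(V, W)) :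
    'Hom('Hom(W, k^o), 'Hom(V, k^o)) :=
  linfun (fun a : 'Hom(W, k^o) => (a \o psi)%VF).

Section TensorTheory.
Variable k : fieldType.
Implicit Types U V W : vectType k.

Lemma linfun_linearE V W (f : V -> W) : linear f -> linfun f =1 f.
Proof.
move=> lf; pose F := GRing.isLinear.Build k V W *:%R f lf.
by pose g : {linear V -> W} := HB.pack f F; exact: (lfunE g).
Qed.

Lemma tens_linearl V W (w : W) : linear (fun v : V => tens v w).
Proof.
by move=> c u v; apply/matrixP=> i j; rewrite !mxE linearP mulrDl mulrA.
Qed.

Lemma tens_linearr V W (v : V) : linear (fun w : W => tens v w).
Proof.
by move=> c u w; apply/matrixP=> i j; rewrite !mxE linearP mulrDr mulrCA.
Qed.

HB.instance Definition _ V W :=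
  bilinear_isBilinear.Build k V W (V ⊗ W) *:%R *:%R (@tens k V W)
    (@tens_linearl V W, @tens_linearr V W).

Fact tlift_is_linear V W U (f : V -> W -> U) :
  linear (fun t : V ⊗ W =>
    \sum_i \sum_j (t i j : k) *: f (vbasis {:V})`_i (vbasis {:W})`_j).
Proof.
move=> c s t; rewrite scaler_sumr -big_split; apply: eq_bigr => i _ /=.
rewrite scaler_sumr -big_split; apply: eq_bigr => j _ /=.
by rewrite !mxE scalerDl scalerA.
Qed.

Lemma tlift_tens V W U (f : V -> W -> U) (v : V) (w : W) :
  bilinear_for *:%R *:%R f -> tlift f (tens v w) = f v w.
Proof.
move=> [fl fr]; rewrite /tlift (linfun_linearE (@tlift_is_linear _ _ _ f)).
have flE y : linfun (f^~ y) =1 f^~ y := linfun_linearE (fl y).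
have frE x : linfun (f x) =1 f x := linfun_linearE (fr x).
transitivity (linfun (f^~ w) v); last exact: flE.
rewrite [in RHS](coord_vbasis (memvf v)) linear_sum; apply: eq_bigr => i _.
rewrite linearZ /= flE; set x := _`_i.
transitivity (coord (vbasis {:V}) i v *: linfun (f x) w); last by rewrite frE.
rewrite [in RHS](coord_vbasis (memvf w)) linear_sum scaler_sumr.
by apply: eq_bigr => j _; rewrite linearZ /= frE mxE scalerA.
Qed.

Lemma tens_coord V W (t : V ⊗ W) :
  t = \sum_i \sum_j (t i j : k) *: tens (vbasis {:V})`_i (vbasis {:W})`_j.
Proof.
have fV := basis_free (vbasisP {:V}); have fW := basis_free (vbasisP {:W}).
apply/matrixP=> i j; rewrite summxE (bigD1 i) //= summxE (bigD1 j) //=.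
rewrite !mxE !coord_free // !eqxx !mulr1 !big1 ?addr0 // => [i' ne|j' ne].
  rewrite summxE big1 // => j' _.
  by rewrite !mxE !coord_free // (negPf ne) mul0r mulr0.
by rewrite !mxE !coord_free // (negPf ne) !mulr0.
Qed.

Lemma tens_ext V W U (f g : 'Hom(V ⊗ W, U)) :
  (forall v w, f (tens v w) = g (tens v w)) -> f = g.
Proof.
move=> fg; apply/lfunP=> t; rewrite (tens_coord t) !linear_sum.
apply: eq_bigr => i _; rewrite !linear_sum; apply: eq_bigr => j _.
by rewrite !linearZ /= fg.
Qed.

Lemma tmap_tens V W V' W' (f : 'Hom(V, V')) (g : 'Hom(W, W')) v w :
  (f ⊗ g)%VF (tens v w) = tens (f v) (g w).
Proof.
rewrite tlift_tens //; split=> u c x y /=.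
  by rewrite linearP tens_linearl.
by rewrite linearP tens_linearr.
Qed.

Lemma tflip_tens V W (v : V) (w : W) : tflip V W (tens v w) = tens w v.
Proof.
by rewrite tlift_tens //; split=> u c x y /=; rewrite (tens_linearr, tens_linearl).
Qed.

Lemma tassoc_tens U V W (u : U) (v : V) (w : W) :
  tassoc U V W (tens (tens u v) w) = tens u (tens v w).
Proof.
have bil (z : W) : bilinear_for *:%R *:%R (fun (x : U) (y : V) => tens x (tens y z)).
  by split=> t c x y /=; rewrite ?tens_linearl ?tens_linearr.
rewrite tlift_tens ?tlift_tens //; split=> [z c s t|t c y z] /=.
  by rewrite linearP.
suff -> : tlift (fun (x : U) (v0 : V) => tens x (tens v0 (c *: y + z))) =
   c *: tlift (fun (x : U) (v0 : V) => tens x (tens v0 y)) +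
   tlift (fun (x : U) (v0 : V) => tens x (tens v0 z)).
  by rewrite add_lfunE scale_lfunE.
apply: tens_ext => x t'; rewrite add_lfunE scale_lfunE !tlift_tens //.
by rewrite !tens_linearr.
Qed.

Lemma tpair_tens V W (a : 'Hom(V, k^o)) (b : 'Hom(W, k^o)) v w :
  tpair a b (tens v w) = a v * b w.
Proof.
rewrite tlift_tens //; split=> u c x y /=.
  by rewrite linearP mulrDl -scalerAl.
by rewrite linearP mulrDr -scalerAr.
Qed.

Lemma transposeE V W (psi : 'Hom(V, W)) (a : 'Hom(W, k^o)) :
  transpose psi a = (a \o psi)%VF.
Proof.
have lin : linear (fun a : 'Hom(W, k^o) => (a \o psi)%VF).
  by move=> c x y; rewrite comp_lfunDl comp_lfunZl.
by rewrite /transpose linfun_linearE.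
Qed.

End TensorTheory.

Section Products.
Variables (k : fieldType) (A : vectType k).
Implicit Types (op : {bilinear A -> A -> A}) (d : 'End(A)).

Definition Lmul op (x : A) : 'End(A) := linfun (fun y => op x y).
Definition Rmul op (y : A) : 'End(A) := linfun (fun x => op x y).

Definition sum_prod (op1 op2 : {bilinear A -> A -> A}) (x y : A) : A :=
  op1 x y + op2 x y.

Definition prec_prod op d (x y : A) : A := op x (d y).
Definition succ_prod op d (x y : A) : A := op (d x) y.

Fact sum_prod_bilinear op1 op2 : bilinear_for *:%R *:%R (sum_prod op1 op2).
Proof.
split=> u c x y; rewrite /sum_prod.
  by rewrite !linearPl /= scalerDr addrACA.
by rewrite !linearPr /= scalerDr addrACA.
Qed.
HB.instance Definition _ op1 op2 :=
  bilinear_isBilinear.Build k A A A *:%R *:%R (sum_prod op1 op2)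
    (sum_prod_bilinear op1 op2).

Fact prec_prod_bilinear op d : bilinear_for *:%R *:%R (prec_prod op d).
Proof.
split=> u c x y; rewrite /prec_prod; first exact: linearPl.
by rewrite linearP linearPr.
Qed.
HB.instance Definition _ op d :=
  bilinear_isBilinear.Build k A A A *:%R *:%R (prec_prod op d)
    (prec_prod_bilinear op d).

Fact succ_prod_bilinear op d : bilinear_for *:%R *:%R (succ_prod op d).
Proof.
split=> u c x y; rewrite /succ_prod; last exact: linearPr.
by rewrite linearP linearPl.
Qed.
HB.instance Definition _ op d :=
  bilinear_isBilinear.Build k A A A *:%R *:%R (succ_prod op d)
    (succ_prod_bilinear op d).

Lemma LmulE op x y : Lmul op x y = op x y.
Proof.
have lin : linear (fun y => op x y) by move=> c u v; rewrite linearPr.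
by rewrite /Lmul linfun_linearE.
Qed.

Lemma RmulE op x y : Rmul op y x = op x y.
Proof.
have lin : linear (fun x => op x y) by move=> c u v; rewrite linearPl.
by rewrite /Rmul linfun_linearE.
Qed.

End Products.

Section LinearDual.
Variables (k : fieldType) (A : vectType k).
Local Notation dualA := 'Hom(A, k^o).

(* linear_dual_prod, linear_dual_coprod and linear_dual_coprod_uniq show that *)
(* this is a one-to-one correspondence.                                       *)
Definition linear_dual (circ : {bilinear dualA -> dualA -> dualA})
    (Delta : 'Hom(A, A ⊗ A)) : Prop :=
  forall (a b : dualA) (x : A), circ a b x = tpair a b (Delta x).

Definition dual_prod (Delta : 'Hom(A, A ⊗ A)) (a b : dualA) : dualA :=
  (tpair a b \o Delta)%VF.

Fact dual_prod_bilinear Delta : bilinear_for *:%R *:%R (dual_prod Delta).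
Proof.
have tl (b : dualA) : linear (fun a : dualA => tpair a b).
  move=> c u v; apply: tens_ext => x y.
  rewrite add_lfunE scale_lfunE !tpair_tens add_lfunE scale_lfunE.
  by rewrite mulrDl -scalerAl.
have tr (a : dualA) : linear (fun b : dualA => tpair a b).
  move=> c u v; apply: tens_ext => x y.
  rewrite add_lfunE scale_lfunE !tpair_tens add_lfunE scale_lfunE.
  by rewrite mulrDr -scalerAr.
by split=> u c x y; rewrite /dual_prod (tl, tr) comp_lfunDl /= comp_lfunZl.
Qed.
HB.instance Definition _ Delta :=
  bilinear_isBilinear.Build k dualA dualA dualA *:%R *:%R (dual_prod Delta)
    (dual_prod_bilinear Delta).

Lemma linear_dual_prod Delta : linear_dual (dual_prod Delta) Delta.
Proof. by move=> a b x; rewrite /= /dual_prod comp_lfunE. Qed.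

Lemma linear_dual_coprod (circ : {bilinear dualA -> dualA -> dualA}) :
  exists Delta, linear_dual circ Delta.
Proof.
pose X := vbasis {:A}.
pose c i : dualA := linfun (coord X i : A -> k^o).
have cE i x : c i x = coord X i x.
  by rewrite /c linfun_linearE // => z u v; rewrite linearP.
have ce (a : dualA) : a = \sum_(i < \dim {:A}) (a X`_i : k) *: c i.
  apply/lfunP=> x; rewrite {1}(coord_vbasis (memvf x)) linear_sum sum_lfunE.
  apply: eq_bigr => i _; rewrite linearZ scale_lfunE cE.
  exact: mulrC.
pose D x : A ⊗ A :=
    \sum_(i < \dim {:A}) \sum_(j < \dim {:A}) (circ (c i) (c j) x : k) *: tens X`_i X`_j.
have Dlin : linear D.
  move=> z u v; rewrite scaler_sumr -big_split; apply: eq_bigr => i _ /=.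
  rewrite scaler_sumr -big_split; apply: eq_bigr => j _ /=.
  by rewrite linearP scalerDl scalerA.
exists (linfun D) => a b x; rewrite (linfun_linearE Dlin) /D linear_sum.
rewrite {1}(ce a) linear_sumlz sum_lfunE; apply: eq_bigr => i _.
rewrite linear_sum linearZl_LR scale_lfunE {1}(ce b) linear_sumr sum_lfunE.
rewrite scaler_sumr; apply: eq_bigr => j _.
rewrite linearZr_LR scale_lfunE [in RHS]linearZ /= tpair_tens.
by rewrite [RHS]mulrC -mulrA.
Qed.

Lemma linear_dual_coprod_uniq circ (Delta1 Delta2 : 'Hom(A, A ⊗ A)) :
  linear_dual circ Delta1 -> linear_dual circ Delta2 -> Delta1 = Delta2.
Proof.
move=> h1 h2; apply/lfunP=> x.
suff tE (t : A ⊗ A) i j : t i j = tpair (linfun (coord (vbasis {:A}) i : A -> k^o))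
    (linfun (coord (vbasis {:A}) j : A -> k^o)) t.
  by apply/matrixP=> i j; rewrite !tE -h1 -h2.
have cE l (y : A) : linfun (coord (vbasis {:A}) l : A -> k^o) y
    = coord (vbasis {:A}) l y.
  by rewrite linfun_linearE // => z u v; rewrite linearP.
have eE : linfun (fun t : A ⊗ A => t i j : k^o) =1 (fun t : A ⊗ A => t i j).
  by move=> t0; rewrite linfun_linearE // => z u v; rewrite !mxE.
set P := linfun _ in eE; set Q := tpair _ _.
suff PQ : P = Q by rewrite -PQ eE.
by apply: tens_ext => u v; rewrite eE tpair_tens !cE mxE.
Qed.

End LinearDual.

Section Bialgebras.
Variables (k : fieldType) (A : vectType k).

Definition is_associative (mu : {bilinear A -> A -> A}) : Prop :=
  forall x y z : A, mu (mu x y) z = mu x (mu y z).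

Definition is_coassociative (Delta : 'Hom(A, A ⊗ A)) : Prop :=
  (tassoc A A A \o (Delta ⊗ \1) \o Delta = (\1 ⊗ Delta) \o Delta)%VF.

Record is_ASI_bialgebra (mu : {bilinear A -> A -> A})
    (Delta : 'Hom(A, A ⊗ A)) : Prop := {
  ASI_assoc : is_associative mu;
  ASI_coassoc : is_coassociative Delta;
  ASI_mul : forall x y : A,
    Delta (mu x y) =
      (Rmul mu y ⊗ \1)%VF (Delta x) + (\1 ⊗ Lmul mu x)%VF (Delta y);
  ASI_antisym : forall x y : A,
    ((Lmul mu x ⊗ \1)%VF - (\1 ⊗ Rmul mu x)%VF) (Delta y) =
      tflip A A (((\1 ⊗ Rmul mu y)%VF - (Lmul mu y ⊗ \1)%VF) (Delta x))
}.

(* Weight 0; d and e are the derivation ∂ and the coderivation ð. *)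
Record is_differential_ASI_bialgebra (mu : {bilinear A -> A -> A})
    (Delta : 'Hom(A, A ⊗ A)) (d e : 'End(A)) : Prop := {
  dASI_ASI : is_ASI_bialgebra mu Delta;
  dASI_deriv : forall x y : A, d (mu x y) = mu (d x) y + mu x (d y);
  dASI_admissiblel : forall x y : A, mu (e x) y = mu x (d y) + e (mu x y);
  dASI_admissibler : forall x y : A, mu x (e y) = mu (d x) y + e (mu x y);
  dASI_coderiv : (Delta \o e)%VF = (((e ⊗ \1) + (\1 ⊗ e)) \o Delta)%VF;
  dASI_coadmissiblel :
    ((d ⊗ \1) \o Delta)%VF = ((\1 ⊗ e) \o Delta)%VF + (Delta \o d)%VF;
  dASI_coadmissibler :
    ((\1 ⊗ d) \o Delta)%VF = ((e ⊗ \1) \o Delta)%VF + (Delta \o d)%VF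
}.

Record is_nc_Novikov_algebra (prec succ : {bilinear A -> A -> A}) : Prop := {
  NovA_succ_prec : forall x y z : A,
    prec (succ x y) z = succ x (prec y z);
  NovA_prec_succ : forall x y z : A,
    sum_prod prec succ (prec x y) z = sum_prod prec succ x (succ y z)
}.

Record is_nc_Novikov_coalgebra (Dprec Dsucc : 'Hom(A, A ⊗ A)) : Prop := {
  NovC_succ_prec :
    (tassoc A A A \o (Dsucc ⊗ \1) \o Dprec = (\1 ⊗ Dprec) \o Dsucc)%VF;
  NovC_prec_succ :
    (tassoc A A A \o (Dprec ⊗ \1) \o (Dprec + Dsucc)
      = (\1 ⊗ Dsucc) \o (Dprec + Dsucc))%VF
}.

Record is_nc_Novikov_bialgebra (prec succ : {bilinear A -> A -> A})
    (Dprec Dsucc : 'Hom(A, A ⊗ A)) : Prop := {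
  NovB_alg : is_nc_Novikov_algebra prec succ;
  NovB_coalg : is_nc_Novikov_coalgebra Dprec Dsucc;
  NovB_prec : forall x y : A,
    let bul : {bilinear A -> A -> A} := sum_prod prec succ in
    let Dbul := Dprec + Dsucc in
    Dprec (prec x y) =
      (Rmul prec y ⊗ \1)%VF (Dprec x) + (\1 ⊗ Lmul bul x)%VF (Dbul y);
  NovB_succ : forall x y : A,
    let bul : {bilinear A -> A -> A} := sum_prod prec succ in
    let Dbul := Dprec + Dsucc in
    Dsucc (succ x y) =
      (Rmul bul y ⊗ \1)%VF (Dbul x) + (\1 ⊗ Lmul succ x)%VF (Dsucc y);
  NovB_bul : forall x y : A,
    let Dbul := Dprec + Dsucc in
    (\1 ⊗ Rmul prec y)%VF (Dbul x)
      + tflip A A ((\1 ⊗ Rmul prec x)%VF (Dbul y)) =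
    (Lmul succ y ⊗ \1)%VF (Dbul x)
      + tflip A A ((Lmul succ x ⊗ \1)%VF (Dbul y));
  NovB_prec_succ : forall x y : A,
    let bul : {bilinear A -> A -> A} := sum_prod prec succ in
    (Lmul bul y ⊗ \1)%VF (Dprec x)
      + tflip A A ((Lmul bul x ⊗ \1)%VF (Dprec y)) =
    (\1 ⊗ Rmul bul y)%VF (Dsucc x)
      + tflip A A ((\1 ⊗ Rmul bul x)%VF (Dsucc y))
}.

End Bialgebras.

(* Main.v *)
Require Import Defs.
From mathcomp Require Import all_boot all_algebra.

Import GRing.Theory.
Local Open Scope ring_scope.

(** The duals of [prec_prod circ (transpose e)] and [succ_prod circ (transpose e)]
    are [(id ⊗ e) Delta] and [(e ⊗ id) Delta].

    The two hypotheses say that [e] and [- d] agree on the left factor of a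
    product and on the left leg of [Delta].  The admissibility axioms of a
    differential ASI bialgebra propagate this to [e (x y) = - d (x y)],
    [x (e y) = - x (d y)] and [Delta e = - Delta d].  So [e] may be exchanged
    for [- d] in these places, although the two maps may differ.

    Since [d] is a derivation and [e] a coderivation, the summed operations are
    total derivatives, [x • y = d (x y)] and [Delta_• = Delta e].  In operator
    form, [L_•(x) = d L(x)] and [R_•(y) = d R(y)], so each Novikov axiom is an
    axiom of the ASI bialgebra decorated with copies of [d] and [e]: the
    algebra and coalgebra axioms come from associativity and coassociativity,
    the axioms for [Delta_prec (x prec y)] and [Delta_succ (x succ y)] from the
    rule for [Delta (x y)] at [x, d y] and [d x, y], and the two flip-symmetric
    ones from antisymmetry, at [d x, e y] and after applying [e ⊗ e].  The case
    [e = - d] satisfies the two hypotheses trivially. *)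

(** * Functoriality of the tensor product *)

Section TensorMaps.
Variable k : fieldType.
Implicit Types U V W : vectType k.

Lemma tmap_comp {V W V1 W1 V2 W2 : vectType k}
    (f : 'Hom(V1, V2)) (g : 'Hom(W1, W2)) (f1 : 'Hom(V, V1)) (g1 : 'Hom(W, W1)) :
  ((f ⊗ g) \o (f1 ⊗ g1))%VF = ((f \o f1) ⊗ (g \o g1))%VF.
Proof. by apply: tens_ext => v w; rewrite comp_lfunE !tmap_tens !comp_lfunE. Qed.

Lemma tmap_compE {V W V1 W1 V2 W2 : vectType k}
    (f : 'Hom(V1, V2)) (g : 'Hom(W1, W2)) (f1 : 'Hom(V, V1)) (g1 : 'Hom(W, W1)) t :
  (f ⊗ g)%VF ((f1 ⊗ g1)%VF t) = ((f \o f1) ⊗ (g \o g1))%VF t.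
Proof. by rewrite -tmap_comp comp_lfunE. Qed.

Lemma tmapNl {V W V1 W1 : vectType k} (f : 'Hom(V, V1)) (g : 'Hom(W, W1)) :
  ((- f) ⊗ g)%VF = - (f ⊗ g)%VF.
Proof.
by apply: tens_ext => v w; rewrite opp_lfunE !tmap_tens opp_lfunE linearNl.
Qed.

Lemma tmapNr {V W V1 W1 : vectType k} (f : 'Hom(V, V1)) (g : 'Hom(W, W1)) :
  (f ⊗ (- g))%VF = - (f ⊗ g)%VF.
Proof.
by apply: tens_ext => v w; rewrite opp_lfunE !tmap_tens opp_lfunE linearNr.
Qed.

Lemma tflip_tmap {V W V1 W1 : vectType k} (f : 'Hom(V, V1)) (g : 'Hom(W, W1)) t :
  tflip V1 W1 ((f ⊗ g)%VF t) = (g ⊗ f)%VF (tflip V W t).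
Proof.
rewrite -[LHS]comp_lfunE -[RHS]comp_lfunE; congr (fun_of_lfun _ t).
by apply: tens_ext => v w; rewrite !comp_lfunE tmap_tens !tflip_tens tmap_tens.
Qed.

Lemma tflipK V W : cancel (tflip V W) (tflip W V).
Proof.
move=> t; rewrite -[LHS]comp_lfunE -[RHS]id_lfunE; congr (fun_of_lfun _ t).
by apply: tens_ext => v w; rewrite comp_lfunE !tflip_tens id_lfunE.
Qed.

Lemma tens_ext3 {U V W X : vectType k} (f g : 'Hom(U ⊗ V ⊗ W, X)) :
  (forall u v w, f (tens (tens u v) w) = g (tens (tens u v) w)) -> f = g.
Proof.
move=> fg; apply: tens_ext => t w.
have tw s : linfun (fun s : U ⊗ V => tens s w) s = tens s w.
  by rewrite linfun_linearE //; exact: tens_linearl.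
rewrite -tw -!comp_lfunE; congr (fun_of_lfun _ t).
by apply: tens_ext => u v; rewrite !comp_lfunE tw fg.
Qed.

Lemma tassoc_tmap {U V W U1 V1 W1 : vectType k}
    (f : 'Hom(U, U1)) (g : 'Hom(V, V1)) (h : 'Hom(W, W1)) :
  (tassoc U1 V1 W1 \o ((f ⊗ g) ⊗ h) = (f ⊗ (g ⊗ h)) \o tassoc U V W)%VF.
Proof.
apply: tens_ext3 => u v w.
by rewrite !comp_lfunE !tmap_tens !tassoc_tens !tmap_tens.
Qed.

(** Coassociativity of [Delta] with an endomorphism inserted on each of the
    three legs; both coalgebra axioms of a Novikov coalgebra have this form. *)
Lemma coassoc_decorated {A : vectType k} {Delta : 'Hom(A, A ⊗ A)}
    (coassoc : is_coassociative Delta) (f g h : 'End(A)) :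
  (tassoc A A A \o (((f ⊗ g) \o Delta) ⊗ h) \o Delta
     = (f ⊗ ((g ⊗ h) \o Delta)) \o Delta)%VF.
Proof.
rewrite -[h in LHS]comp_lfun1r -tmap_comp comp_lfunA tassoc_tmap -!comp_lfunA.
rewrite (comp_lfunA (tassoc _ _ _)) coassoc comp_lfunA tmap_comp.
by rewrite comp_lfun1r.
Qed.

End TensorMaps.

(** * Duals and operators of the derived products *)

Section DerivedProducts.
Variables (k : fieldType) (A : vectType k).

Lemma dual_prec_coprod (Delta Dprec : 'Hom(A, A ⊗ A)) (e : 'End(A))
    (circ : {bilinear 'Hom(A, k^o) -> 'Hom(A, k^o) -> 'Hom(A, k^o)}) :
  linear_dual circ Delta ->
  linear_dual (prec_prod circ (transpose e)) Dprec ->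
  Dprec = ((\1 ⊗ e) \o Delta)%VF.
Proof.
move=> dual_circ /linear_dual_coprod_uniq; apply => a b x.
rewrite /= /prec_prod dual_circ transposeE comp_lfunE -[RHS]comp_lfunE.
congr (fun_of_lfun _ (Delta x)); apply: tens_ext => v w.
by rewrite comp_lfunE tmap_tens !tpair_tens comp_lfunE id_lfunE.
Qed.

Lemma dual_succ_coprod (Delta Dsucc : 'Hom(A, A ⊗ A)) (e : 'End(A))
    (circ : {bilinear 'Hom(A, k^o) -> 'Hom(A, k^o) -> 'Hom(A, k^o)}) :
  linear_dual circ Delta ->
  linear_dual (succ_prod circ (transpose e)) Dsucc ->
  Dsucc = ((e ⊗ \1) \o Delta)%VF.
Proof.
move=> dual_circ /linear_dual_coprod_uniq; apply => a b x.
rewrite /= /succ_prod dual_circ transposeE comp_lfunE -[RHS]comp_lfunE.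
congr (fun_of_lfun _ (Delta x)); apply: tens_ext => v w.
by rewrite comp_lfunE tmap_tens !tpair_tens comp_lfunE id_lfunE.
Qed.

Variables (mu : {bilinear A -> A -> A}) (d : 'End(A)).

Lemma Rmul_prec y : Rmul (prec_prod mu d) y = Rmul mu (d y).
Proof. by apply/lfunP => x; rewrite !RmulE. Qed.

Lemma Lmul_succ x : Lmul (succ_prod mu d) x = Lmul mu (d x).
Proof. by apply/lfunP => y; rewrite !LmulE. Qed.

Hypothesis deriv : forall x y, d (mu x y) = mu (d x) y + mu x (d y).

Lemma sum_prodE x y :
  sum_prod (prec_prod mu d) (succ_prod mu d) x y = d (mu x y).
Proof. by rewrite /sum_prod /= /prec_prod /succ_prod deriv addrC. Qed.

Lemma Lmul_sum x :
  Lmul (sum_prod (prec_prod mu d) (succ_prod mu d)) x = (d \o Lmul mu x)%VF.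
Proof. by apply/lfunP => y; rewrite comp_lfunE !LmulE /= sum_prodE. Qed.

Lemma Rmul_sum y :
  Rmul (sum_prod (prec_prod mu d) (succ_prod mu d)) y = (d \o Rmul mu y)%VF.
Proof. by apply/lfunP => x; rewrite comp_lfunE !RmulE /= sum_prodE. Qed.

Lemma derivation_nc_Novikov_algebra :
  is_associative mu -> is_nc_Novikov_algebra (prec_prod mu d) (succ_prod mu d).
Proof.
move=> assoc; split=> x y z; first exact: assoc.
by rewrite !sum_prodE /= /prec_prod /succ_prod assoc.
Qed.

End DerivedProducts.

(** * The Novikov bialgebra *)

Section NovikovBialgebra.
Variables (k : fieldType) (A : vectType k) (mu : {bilinear A -> A -> A}).
Variables (Delta : 'Hom(A, A ⊗ A)) (d e : 'End(A)).
Hypothesis hA : is_differential_ASI_bialgebra mu Delta d e.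
Hypothesis mu_eN : forall x y : A, mu (e x) y = - mu (d x) y.
Hypothesis Delta_eN : ((e ⊗ \1) \o Delta)%VF = - ((d ⊗ \1) \o Delta)%VF.

Lemma e_muN x y : e (mu x y) = - d (mu x y).
Proof.
rewrite (dASI_deriv hA) opprD -mu_eN (dASI_admissiblel hA).
by rewrite addrAC addrN add0r.
Qed.

Lemma mu_eNr x y : mu x (e y) = - mu x (d y).
Proof.
by rewrite (dASI_admissibler hA) e_muN (dASI_deriv hA) opprD addrA addrN add0r.
Qed.

Lemma Delta_eE x : Delta (e x) = (e ⊗ \1)%VF (Delta x) + (\1 ⊗ e)%VF (Delta x).
Proof. by have /lfunP/(_ x) := dASI_coderiv hA; rewrite !lfunE /= lfunE. Qed.

Lemma Delta_dE x : Delta (d x) = - Delta (e x).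
Proof.
have /lfunP/(_ x) := dASI_coadmissiblel hA.
have /lfunP/(_ x) := Delta_eN; rewrite !lfunE /= !lfunE Delta_eE /= => ->.
by move=> ->; rewrite opprD opprK addrAC addrN add0r.
Qed.

Lemma e_LmulN x : (e \o Lmul mu x = - (d \o Lmul mu x))%VF.
Proof. by apply/lfunP => y; rewrite opp_lfunE !comp_lfunE LmulE e_muN. Qed.

Lemma e_RmulN y : (e \o Rmul mu y = - (d \o Rmul mu y))%VF.
Proof. by apply/lfunP => x; rewrite opp_lfunE !comp_lfunE RmulE e_muN. Qed.

Lemma Lmul_eN x : Lmul mu (e x) = - Lmul mu (d x).
Proof. by apply/lfunP => y; rewrite opp_lfunE !LmulE mu_eN. Qed.

Lemma Rmul_eN y : Rmul mu (e y) = - Rmul mu (d y).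
Proof. by apply/lfunP => x; rewrite opp_lfunE !RmulE mu_eNr. Qed.

Let Dprec := ((\1 ⊗ e) \o Delta)%VF.
Let Dsucc := ((e ⊗ \1) \o Delta)%VF.

Lemma sum_coprodE : Dprec + Dsucc = (Delta \o e)%VF.
Proof.
by apply/lfunP => x; rewrite add_lfunE !comp_lfunE Delta_eE addrC.
Qed.

Lemma coderivation_nc_Novikov_coalgebra : is_nc_Novikov_coalgebra Dprec Dsucc.
Proof.
have coassoc := ASI_coassoc (dASI_ASI hA); split.
  (* Both sides carry [e] on the two outer legs of the iterated coproduct. *)
  rewrite /Dprec /Dsucc comp_lfunA -(comp_lfunA (tassoc _ _ _)) tmap_comp.
  rewrite comp_lfun1r comp_lfun1l coassoc_decorated //.
  by rewrite comp_lfunA tmap_comp comp_lfun1l comp_lfun1r.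
(* Both sides carry [e] on the middle leg, after [e] on the argument. *)
by rewrite sum_coprodE !comp_lfunA coassoc_decorated.
Qed.

(** Antisymmetry with the terms in [x] on one side and those in [y] on the
    other, which matches the shape of the flip-symmetric Novikov axioms. *)
Lemma antisym_flip x y :
  (Lmul mu y ⊗ \1)%VF (Delta x) + tflip A A ((Lmul mu x ⊗ \1)%VF (Delta y)) =
  (\1 ⊗ Rmul mu y)%VF (Delta x) + tflip A A ((\1 ⊗ Rmul mu x)%VF (Delta y)).
Proof.
have /(congr1 (tflip A A)) := ASI_antisym (dASI_ASI hA) x y.
rewrite tflipK !add_lfunE !opp_lfunE linearB /= => /eqP.
by rewrite subr_eq addrAC eq_sym subr_eq => /eqP ->; rewrite addrC.
Qed.

Lemma differential_nc_Novikov_bialgebra :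
  is_nc_Novikov_bialgebra (prec_prod mu d) (succ_prod mu d) Dprec Dsucc.
Proof.
have deriv := dASI_deriv hA.
have Delta_mu := ASI_mul (dASI_ASI hA).
split.
- exact/derivation_nc_Novikov_algebra/(ASI_assoc (dASI_ASI hA)).
- exact: coderivation_nc_Novikov_coalgebra.
- move=> x y bul Dbul; rewrite /bul /Dbul sum_coprodE Lmul_sum // Rmul_prec.
  rewrite /Dprec !comp_lfunE /= /prec_prod Delta_mu linearD /= !tmap_compE.
  rewrite !comp_lfun1l !comp_lfun1r e_LmulN Delta_dE tmapNr.
  by rewrite opp_lfunE linearN opprK.
- move=> x y bul Dbul; rewrite /bul /Dbul sum_coprodE Rmul_sum // Lmul_succ.
  rewrite /Dsucc !comp_lfunE /= /succ_prod Delta_mu linearD /= !tmap_compE.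
  rewrite !comp_lfun1l !comp_lfun1r e_RmulN Delta_dE tmapNl.
  by rewrite opp_lfunE linearN opprK.
- move=> x y Dbul; rewrite /Dbul sum_coprodE !Rmul_prec !Lmul_succ !comp_lfunE.
  (* Antisymmetry at [d x] and [e y]: turning [Delta (d x)] into [Delta (e x)]
     and [e y] into [d y] inside the products introduces two signs, which
     cancel. *)
  have := antisym_flip (d x) (e y).
  rewrite Delta_dE Lmul_eN Rmul_eN tmapNl tmapNr !opp_lfunE !linearN !opprK.
  by [].
- move=> x y bul; rewrite /bul !Lmul_sum // !Rmul_sum //.
  (* Outside a product [d] is [- e], so both sides become antisymmetry at [x]
     and [y] after [e ⊗ e]. *)
  rewrite -[(d \o Lmul mu y)%VF]opprK -[(d \o Lmul mu x)%VF]opprK.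
  rewrite -[(d \o Rmul mu y)%VF]opprK -[(d \o Rmul mu x)%VF]opprK.
  rewrite -!e_LmulN -!e_RmulN /Dprec /Dsucc !comp_lfunE !tmap_compE.
  rewrite !comp_lfun1l !comp_lfun1r !tmapNl !tmapNr !opp_lfunE !linearN.
  rewrite -!opprD; congr (- _); move/(congr1 (e ⊗ e)%VF): (antisym_flip x y).
  by rewrite !linearD /= -!tflip_tmap !tmap_compE !comp_lfun1r.
Qed.

End NovikovBialgebra.

Theorem theorem5p29 (k : fieldType) (k_char0 : [pchar k] =i pred0)
  (A : vectType k) (mu : {bilinear A -> A -> A}) (Delta : 'Hom(A, A ⊗ A))
  (d e : 'End(A)) (hA : is_differential_ASI_bialgebra mu Delta d e)
  (circ : {bilinear 'Hom(A, k^o) -> 'Hom(A, k^o) -> 'Hom(A, k^o)})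
  (hcirc : linear_dual circ Delta)
  (Dprec Dsucc : 'Hom(A, A ⊗ A))
  (hprec : linear_dual (prec_prod circ (transpose e)) Dprec)
  (hsucc : linear_dual (succ_prod circ (transpose e)) Dsucc) :
  ((forall x y : A, mu (e x) y = - mu (d x) y) ->
   ((e ⊗ \1) \o Delta)%VF = - ((d ⊗ \1) \o Delta)%VF ->
   is_nc_Novikov_bialgebra (prec_prod mu d) (succ_prod mu d) Dprec Dsucc) /\
  (e = - d ->
   is_nc_Novikov_bialgebra (prec_prod mu d) (succ_prod mu d) Dprec Dsucc).
Proof.
rewrite (dual_prec_coprod _ _ _ _ _ _ hcirc hprec).
rewrite (dual_succ_coprod _ _ _ _ _ _ hcirc hsucc).
have main := differential_nc_Novikov_bialgebra _ _ _ _ _ _ hA.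
split=> [|eN]; first exact: main.
apply: main => [x y|]; first by rewrite eN opp_lfunE linearNl.
by rewrite eN tmapNl comp_lfunNl.
Qed.
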